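(* Let $p>0$, $\lambda>0$, $\omega=\frac{2\pi}{p}$, $\mu\in\mathbb{R}$, and let $e\in C(\mathbb{R})$ satisfy $e(t+p)=e(t)$ for all $t$ and $\int_0^p e(t)\,dt=0$. Assume that $g\in C^1(\mathbb{R})$ is bounded ($|g(x)|\le M$ for all $x\in\mathbb{R}$ and some $M>0$), that $$|g'(x)|<\frac{\lambda^2}{4}+\omega^2\quad\text{for all } x\in\mathbb{R},$$ and that the limits $g(\infty)=\lim_{x\to\infty}g(x)$ and $g(-\infty)=\lim_{x\to-\infty}g(x)$ exist and $$g(-\infty)<g(x)<g(\infty)\quad\text{for all } x\in\mathbb{R}.$$ Then the equation $$x''(t)+\lambda x'(t)+g(x(t))=\mu+e(t)$$ has a $p$-periodic solution if and only if $$g(-\infty)<\mu<g(\infty).$$ If this last condition fails, then all solutions of the equation are unbounded as $t\to\infty$ and as $t\to-\infty$.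
   Context: A solution $x(t)$ is unbounded as $t\to\infty$ (respectively $t\to-\infty$) if it is unbounded on $[0,\infty)$ (respectively on $(-\infty,0]$). *)

(* Defs.v *)
From Stdlib Require Import Reals.
From Coquelicot Require Import Coquelicot.
Open Scope R_scope.

Definition periodic (p : R) (f : R -> R) : Prop :=
  forall t : R, f (t + p) = f t.

Definition continuously_differentiable (f : R -> R) : Prop :=
  forall t : R, ex_derive f t /\ continuous (Derive f) t.

(* Classical solution of x'' + lam x' + g(x) = mu + e(t) on the whole line.
   [Derive] is total, so differentiability of x and x' is required explicitly;
   for continuous g and e, continuity of x'' then follows from the equation. *)
Definition is_solution (lam mu : R) (g e x : R -> R) : Prop :=
  forall t : R,
    ex_derive x t /\ ex_derive (Derive x) t /\
    Derive (Derive x) t + lam * Derive x t + g (x t) = mu + e t.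

Definition unbounded_on (D : R -> Prop) (x : R -> R) : Prop :=
  ~ (exists K : R, forall t : R, D t -> Rabs (x t) <= K).

Definition unbounded_at_p_infty (x : R -> R) : Prop :=
  unbounded_on (fun t => 0 <= t) x.

Definition unbounded_at_m_infty (x : R -> R) : Prop :=
  unbounded_on (fun t => t <= 0) x.

(* Main.v *)
Require Import Defs.
From Stdlib Require Import Reals ZArith Lra Lia ClassicalEpsilon.
From Coquelicot Require Import Coquelicot.
Open Scope R_scope.

(** Write [E] for the primitive of [e]; it is bounded, because [e] is periodic
    with mean zero.  Along a solution the corrected momentum
    [q = x' + lam x - E] satisfies [q' = mu - g x] ([is_derive_momentum]), and
    everything is read off this identity.

    Nonexistence.  If [mu] is not strictly between the limits of [g], then
    [mu - g] has a constant sign, say it is positive.  On a half-line on which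
    [x] is bounded, [mu - g x] is bounded below by some [dl > 0] by compactness,
    so [q], then [x'], grows at least like [dl t], and [x] like [dl t^2 / 2],
    which is absurd ([excess_forcing_unbounded]).  Reversing time replaces [lam]
    by [- lam] and handles the other half-line; the reflection [x -> - x]
    handles the other sign.  A periodic solution is bounded, so the necessity of
    [gminf < mu < gpinf] is a special case.

    Existence.  The bound on [g'] makes [g] globally Lipschitz, so the initial
    value problem is globally well posed and its period map is continuous
    ([phase_orbit_exists], [phase_orbit_dependence]).  A periodic solution is a
    fixed point of this map, that is, a common zero of the variations over one
    period of [x'] and of [x' + lam x], as functions of [(x 0, x' 0)].  Since
    the force is bounded and [lam > 0], a large velocity decreases in absolute
    value.  With [x'] so confined, [x] moves by a bounded amount in one period;
    hence if [x 0] is large and positive then [g x > mu] throughout the period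
    and [x' + lam x] decreases, while it increases if [x 0] is large and
    negative.  These are the sign conditions of the Poincare-Miranda theorem on
    a rectangle ([poincare_miranda_2d]), which is proved here from a Sperner
    lemma on square grids. *)

(** * A planar fixed-point principle *)

Inductive color := ColA | ColB | ColC.

Definition is_AB_edge (k l : color) : bool :=
  match k, l with
  | ColA, ColB | ColB, ColA => true
  | _, _ => false
  end.

Fixpoint xor_sum (f : nat -> bool) (n : nat) : bool :=
  match n with
  | O => false
  | S m => xorb (xor_sum f m) (f m)
  end.

Lemma xor_sum_telescope (f : nat -> bool) (n : nat) :
  xor_sum (fun i => xorb (f i) (f (S i))) n = xorb (f 0%nat) (f n).
Proof.
  induction n as [|n IH]; simpl.
  - now destruct (f 0%nat).
  - rewrite IH. now destruct (f 0%nat), (f n), (f (S n)).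
Qed.

Lemma xor_sum_xorb (f g : nat -> bool) (n : nat) :
  xor_sum (fun i => xorb (f i) (g i)) n = xorb (xor_sum f n) (xor_sum g n).
Proof.
  induction n as [|n IH]; simpl; auto.
  rewrite IH. now destruct (xor_sum f n), (xor_sum g n), (f n), (g n).
Qed.

Lemma xor_sum_ext (f g : nat -> bool) (n : nat) :
  (forall i, (i < n)%nat -> f i = g i) -> xor_sum f n = xor_sum g n.
Proof.
  induction n as [|n IH]; simpl; intros H; auto.
  rewrite IH by (intros; apply H; lia). rewrite H by lia. reflexivity.
Qed.

(** Walking around a 4-cycle that misses one of the three colors, one crosses
    between A and B an even number of times: either A or B is absent and there
    is no crossing, or only A and B occur and the crossings alternate. *)
Lemma four_cycle_parity (k00 k10 k01 k11 : color) :
  xorb (is_AB_edge k00 k10) (is_AB_edge k01 k11)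
    = xorb (is_AB_edge k00 k01) (is_AB_edge k10 k11)
  \/ (forall k, k = k00 \/ k = k10 \/ k = k01 \/ k = k11).
Proof.
  destruct k00, k10, k01, k11; simpl; auto;
    right; intros []; auto.
Qed.

(** Sperner's lemma on a square grid.  If no cell is three-colored, the number
    of A-B edges of a row has a parity that does not depend on the row, because
    cell by cell its variation telescopes to the vertical edges of the two
    lateral sides, none of which joins A and B.  But this parity is odd on the
    bottom row and even on the top one. *)
Lemma sperner_square (c : nat -> nat -> color) (n : nat) :
  (forall j, (j <= n)%nat -> c 0%nat j = ColA) ->
  (forall j, (j <= n)%nat -> c n j <> ColA) ->
  (forall i, (i <= n)%nat -> c i 0%nat <> ColC) ->
  (forall i, (i <= n)%nat -> c i n <> ColB) ->
  exists i j, (i < n)%nat /\ (j < n)%nat /\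
    forall k, k = c i j \/ k = c (S i) j \/ k = c i (S j) \/ k = c (S i) (S j).
Proof.
  intros Hleft Hright Hbot Htop.
  apply NNPP; intros Hno.
  set (h := fun j i => is_AB_edge (c i j) (c (S i) j)).
  set (v := fun j i => is_AB_edge (c i j) (c i (S j))).
  assert (Hstep : forall j, (j < n)%nat ->
            xor_sum (h j) n = xor_sum (h (S j)) n).
  { intros j Hj.
    assert (E : xor_sum (fun i => xorb (h j i) (h (S j) i)) n
                = xor_sum (fun i => xorb (v j i) (v j (S i))) n).
    { apply xor_sum_ext; intros i Hi.
      destruct (four_cycle_parity (c i j) (c (S i) j) (c i (S j)) (c (S i) (S j)))
        as [E|E]; [exact E|].
      exfalso; apply Hno; exists i, j; auto. }
    rewrite xor_sum_xorb, xor_sum_telescope in E.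
    assert (E0 : v j 0%nat = false).
    { unfold v. now rewrite !Hleft by lia. }
    assert (En : v j n = false).
    { unfold v.
      generalize (Hright j ltac:(lia)) (Hright (S j) ltac:(lia)).
      destruct (c n j), (c n (S j)); simpl; congruence. }
    rewrite E0, En in E. simpl in E.
    destruct (xor_sum (h j) n), (xor_sum (h (S j)) n); simpl in E; congruence. }
  assert (Hall : forall j, (j <= n)%nat -> xor_sum (h 0%nat) n = xor_sum (h j) n).
  { induction j as [|j IH]; intros Hj; auto.
    rewrite IH by lia. apply Hstep; lia. }
  assert (Hn : xor_sum (h n) n = false).
  { rewrite (xor_sum_ext _ (fun i => xorb false false)).
    - apply (xor_sum_telescope (fun _ => false)).
    - intros i Hi. unfold h.
      generalize (Htop i ltac:(lia)) (Htop (S i) ltac:(lia)).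
      destruct (c i n), (c (S i) n); simpl; congruence. }
  assert (H0 : xor_sum (h 0%nat) n = true).
  { set (b := fun i => match c i 0%nat with ColB => true | _ => false end).
    rewrite (xor_sum_ext _ (fun i => xorb (b i) (b (S i)))).
    - rewrite xor_sum_telescope. unfold b. rewrite Hleft by lia.
      generalize (Hright 0%nat ltac:(lia)) (Hbot n ltac:(lia)).
      destruct (c n 0%nat); simpl; congruence.
    - intros i Hi. unfold h, b.
      generalize (Hbot i ltac:(lia)) (Hbot (S i) ltac:(lia)).
      destruct (c i 0%nat), (c (S i) 0%nat); simpl; congruence. }
  specialize (Hall n ltac:(lia)). congruence.
Qed.

(** Three patterns suffice to detect a zero: when they accumulate at a point,
    A and C force [f1 = 0] there, B and C force [f2 = 0]. *)
Definition sign_color (y1 y2 : R) : color :=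
  if Rlt_dec y1 0 then ColA else if Rlt_dec y2 0 then ColB else ColC.

(** Near a point that is not a common zero one of the two functions keeps a
    strict sign, and this excludes a color. *)
Lemma sign_color_missing (f1 f2 : R -> R -> R) (x y : R) :
  continuity_2d_pt f1 x y -> continuity_2d_pt f2 x y ->
  ~ (f1 x y = 0 /\ f2 x y = 0) ->
  exists k, locally_2d (fun u v => sign_color (f1 u v) (f2 u v) <> k) x y.
Proof.
  intros C1 C2 Hnz.
  assert (near : forall f : R -> R -> R, continuity_2d_pt f x y ->
            (0 < f x y -> locally_2d (fun u v => 0 < f u v) x y) /\
            (f x y < 0 -> locally_2d (fun u v => f u v < 0) x y)).
  { intros f C; split; intros Hs.
    - destruct (C (mkposreal _ Hs)) as [d Hd]. exists d. intros u v Hu Hv.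
      generalize (Rabs_def2 _ _ (Hd u v Hu Hv)); simpl; lra.
    - assert (Hs' : 0 < - f x y) by lra.
      destruct (C (mkposreal _ Hs')) as [d Hd]. exists d. intros u v Hu Hv.
      generalize (Rabs_def2 _ _ (Hd u v Hu Hv)); simpl; lra. }
  assert (choose : forall (P : R -> R -> Prop) k,
            (forall u v, P u v -> sign_color (f1 u v) (f2 u v) <> k) ->
            locally_2d P x y ->
            exists k, locally_2d (fun u v => sign_color (f1 u v) (f2 u v) <> k) x y).
  { intros P k HP [d Hd]. exists k, d. auto. }
  destruct (near f1 C1) as [P1 N1], (near f2 C2) as [P2 N2].
  destruct (Rtotal_order (f1 x y) 0) as [H|[H|H]].
  - apply (choose _ ColC) with (2 := N1 H). intros u v Huv. unfold sign_color.
    destruct (Rlt_dec (f1 u v) 0); [congruence|lra].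
  - destruct (Rtotal_order (f2 x y) 0) as [H'|[H'|H']].
    + apply (choose _ ColC) with (2 := N2 H'). intros u v Huv. unfold sign_color.
      destruct (Rlt_dec (f1 u v) 0); [congruence|].
      destruct (Rlt_dec (f2 u v) 0); [congruence|lra].
    + tauto.
    + apply (choose _ ColB) with (2 := P2 H'). intros u v Huv. unfold sign_color.
      destruct (Rlt_dec (f1 u v) 0); [congruence|].
      destruct (Rlt_dec (f2 u v) 0); [lra|congruence].
  - apply (choose _ ColA) with (2 := P1 H). intros u v Huv. unfold sign_color.
    destruct (Rlt_dec (f1 u v) 0); [lra|].
    destruct (Rlt_dec (f2 u v) 0); congruence.
Qed.

Lemma grid_point_bounds (a l : R) (n i : nat) :
  0 < l -> (0 < n)%nat -> (i <= n)%nat ->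
  a <= a + l * (INR i / INR n) <= a + l.
Proof.
  intros Hl Hn Hi.
  assert (0 < INR n) by (apply lt_0_INR; lia).
  assert (0 <= INR i / INR n) by (apply Rdiv_le_0_compat; [apply pos_INR|lra]).
  assert (INR i / INR n <= 1).
  { apply Rle_div_l; [lra|]. rewrite Rmult_1_l. apply le_INR; lia. }
  nra.
Qed.

Lemma grid_step_small (a l d x : R) (n i : nat) :
  0 < l -> (0 < n)%nat -> l < d * INR n ->
  Rabs (a + l * (INR i / INR n) - x) < d ->
  Rabs (a + l * (INR (S i) / INR n) - x) < 2 * d.
Proof.
  intros Hl Hn Hd Hx.
  assert (0 < INR n) by (apply lt_0_INR; lia).
  replace (a + l * (INR (S i) / INR n) - x)
    with ((a + l * (INR i / INR n) - x) + l / INR n)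
    by (rewrite S_INR; field; lra).
  assert (0 < l / INR n) by (apply Rdiv_lt_0_compat; lra).
  assert (l / INR n < d) by (apply Rlt_div_l; lra).
  eapply Rle_lt_trans; [apply Rabs_triang|].
  rewrite (Rabs_pos_eq (l / INR n)); lra.
Qed.

(** The Poincare-Miranda theorem in the plane.  In the absence of a zero,
    compactness gives a mesh below which no grid cell carries all three sign
    patterns, against Sperner's lemma. *)
Theorem poincare_miranda_2d (f1 f2 : R -> R -> R) (a b c d : R) :
  a < b -> c < d ->
  (forall u v, continuity_2d_pt f1 u v) ->
  (forall u v, continuity_2d_pt f2 u v) ->
  (forall v, c <= v <= d -> f1 a v < 0 <= f1 b v) ->
  (forall u, a <= u <= b -> f2 u c < 0 <= f2 u d) ->
  exists u v, a <= u <= b /\ c <= v <= d /\ f1 u v = 0 /\ f2 u v = 0.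
Proof.
  intros Hab Hcd C1 C2 Hlr Hbt.
  apply NNPP; intros Hno.
  assert (Hdelta : forall u v, exists dl : posreal,
            a <= u <= b -> c <= v <= d ->
            exists k, forall x y, Rabs (x - u) < 2 * dl -> Rabs (y - v) < 2 * dl ->
              sign_color (f1 x y) (f2 x y) <> k).
  { intros u v.
    destruct (classic ((a <= u <= b /\ c <= v <= d))) as [Hin|Hout].
    - destruct (sign_color_missing f1 f2 u v (C1 u v) (C2 u v)) as [k [dl Hdl]].
      + intros [Z1 Z2]. apply Hno. exists u, v. tauto.
      (* Half of the radius, so that all corners of a small cell which has one
         corner within the smaller radius lie within the larger one. *)
      + exists (pos_div_2 dl). intros _ _. exists k. intros x y Hx Hy.
        apply Hdl; simpl in *; lra.
    - exists (mkposreal 1 Rlt_0_1). tauto. }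
  set (delta := fun u v => proj1_sig (constructive_indefinite_description _ (Hdelta u v))).
  destruct (compactness_value_2d a b c d delta) as [m Hm].
  destruct (INR_unbounded ((b - a + (d - c)) / m)) as [n Hn].
  assert (Hm0 := cond_pos m).
  assert (Hnm : b - a + (d - c) < m * INR n).
  { apply Rlt_div_l in Hn; lra. }
  assert (Hn0 : (0 < n)%nat).
  { destruct n; [simpl in Hnm; lra|lia]. }
  assert (HnR : 0 < INR n) by (apply lt_0_INR; lia).
  set (X := fun i => a + (b - a) * (INR i / INR n)).
  set (Y := fun j => c + (d - c) * (INR j / INR n)).
  assert (HX : forall i, (i <= n)%nat -> a <= X i <= b).
  { intros i Hi. unfold X.
    destruct (grid_point_bounds a (b - a) n i); auto; lra. }
  assert (HY : forall i, (i <= n)%nat -> c <= Y i <= d).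
  { intros i Hi. unfold Y.
    destruct (grid_point_bounds c (d - c) n i); auto; lra. }
  assert (X0 : X 0%nat = a) by (unfold X; simpl; field; lra).
  assert (Xn : X n = b) by (unfold X; field; lra).
  assert (Y0 : Y 0%nat = c) by (unfold Y; simpl; field; lra).
  assert (Yn : Y n = d) by (unfold Y; field; lra).
  destruct (sperner_square (fun i j => sign_color (f1 (X i) (Y j)) (f2 (X i) (Y j))) n)
    as (i & j & Hi & Hj & Hrainbow).
  - intros j Hj. rewrite X0. unfold sign_color.
    specialize (Hlr (Y j) (HY j Hj)). destruct (Rlt_dec _ 0); [reflexivity|lra].
  - intros j Hj. rewrite Xn. unfold sign_color.
    specialize (Hlr (Y j) (HY j Hj)). destruct (Rlt_dec _ 0); [lra|].
    destruct (Rlt_dec _ 0); congruence.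
  - intros i Hi. rewrite Y0. unfold sign_color.
    specialize (Hbt (X i) (HX i Hi)). destruct (Rlt_dec _ 0); [congruence|].
    destruct (Rlt_dec _ 0); [congruence|lra].
  - intros i Hi. rewrite Yn. unfold sign_color.
    specialize (Hbt (X i) (HX i Hi)). destruct (Rlt_dec _ 0); [congruence|].
    destruct (Rlt_dec _ 0); [lra|congruence].
  - apply (Hm (X i) (Y j)); [apply HX; lia|apply HY; lia|].
    intros (u & v & Hu & Hv & Hxu & Hyv & Hmd).
    revert Hxu Hyv Hmd. unfold delta.
    destruct (constructive_indefinite_description _ (Hdelta u v)) as [dl Hdl]; simpl.
    intros Hxu Hyv Hmd.
    destruct (Hdl Hu Hv) as [k Hk].
    assert (HSx : Rabs (X (S i) - u) < 2 * dl).
    { apply grid_step_small; auto; try lra. nra. }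
    assert (HSy : Rabs (Y (S j) - v) < 2 * dl).
    { apply grid_step_small; auto; try lra. nra. }
    assert (Rabs (X i - u) < 2 * dl) by (generalize (cond_pos dl); lra).
    assert (Rabs (Y j - v) < 2 * dl) by (generalize (cond_pos dl); lra).
    destruct (Hrainbow k) as [E|[E|[E|E]]]; symmetry in E; revert E; apply Hk; auto.
Qed.

(** * Second-order equations with Lipschitz nonlinearity *)

Lemma Derive_of_is_derive (f : R -> R) (t l : R) :
  is_derive f t l -> Derive (fun r : R => f r) t = l.
Proof. exact (is_derive_unique f t l). Qed.

Lemma derive_nonneg_le (f df : R -> R) (a b : R) :
  a <= b -> (forall t, is_derive f t (df t)) ->
  (forall t, a <= t <= b -> 0 <= df t) -> f a <= f b.
Proof.
  intros Hab Hf Hdf.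
  destruct (MVT_gen f a b df) as [c [Hc E]].
  - intros; apply Hf.
  - intros t _. apply continuity_pt_filterlim, (ex_derive_continuous f). eexists; apply Hf.
  - rewrite Rmin_left, Rmax_right in Hc by lra.
    specialize (Hdf c Hc). nra.
Qed.

Lemma derive_pos_lt (f df : R -> R) (a b : R) :
  a < b -> (forall t, is_derive f t (df t)) ->
  (forall t, a <= t <= b -> 0 < df t) -> f a < f b.
Proof.
  intros Hab Hf Hdf.
  destruct (MVT_gen f a b df) as [c [Hc E]].
  - intros; apply Hf.
  - intros t _. apply continuity_pt_filterlim, (ex_derive_continuous f). eexists; apply Hf.
  - rewrite Rmin_left, Rmax_right in Hc by lra.
    specialize (Hdf c Hc). nra.
Qed.

Lemma is_derive_primitive (f : R -> R) (t : R) :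
  (forall s, continuous f s) -> is_derive (fun t => RInt f 0 t) t (f t).
Proof.
  intros Hf. apply is_derive_RInt with (a := 0); [|apply Hf].
  apply filter_forall. intros y. apply RInt_correct, ex_RInt_continuous.
  intros; apply Hf.
Qed.

Lemma primitive_exp_bound_pos (F f : R -> R) (A K : R) :
  0 < K -> (forall t, is_derive F t (f t)) -> F 0 = 0 ->
  (forall t, f t <= A * exp (K * Rabs t)) -> 0 <= A ->
  forall t, 0 <= t -> F t <= A / K * exp (K * Rabs t).
Proof.
  intros HK HF F0 Hf HA t Ht.
  assert (H : A / K * exp (K * 0) - F 0 <= A / K * exp (K * t) - F t).
  { apply (derive_nonneg_le (fun t => A / K * exp (K * t) - F t)
             (fun t => A * exp (K * t) - f t)); auto.
    - intros s. auto_derive.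
      + eexists; apply HF.
      + rewrite (Derive_of_is_derive F s (f s)) by apply HF. field. lra.
    - intros s Hs. specialize (Hf s). rewrite Rabs_pos_eq in Hf; lra. }
  rewrite F0, Rmult_0_r, exp_0 in H. rewrite Rabs_pos_eq by lra.
  assert (0 <= A / K) by (apply Rdiv_le_0_compat; lra). lra.
Qed.

(** Integration gains a factor [1/K] in the norm weighted by [exp (K |t|)]:
    a large [K] turns any Lipschitz Volterra operator into a contraction on the
    whole line. *)
Lemma primitive_exp_bound (F f : R -> R) (A K : R) :
  0 < K -> (forall t, is_derive F t (f t)) -> F 0 = 0 ->
  (forall t, Rabs (f t) <= A * exp (K * Rabs t)) ->
  forall t, Rabs (F t) <= A / K * exp (K * Rabs t).
Proof.
  intros HK HF F0 Hf t.
  assert (HA : 0 <= A).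
  { generalize (Hf 0) (Rabs_pos (f 0)). rewrite Rabs_R0, Rmult_0_r, exp_0. lra. }
  assert (Hf2 : forall t, f t <= A * exp (K * Rabs t) /\ - f t <= A * exp (K * Rabs t)).
  { intros s. generalize (Hf s) (Rle_abs (f s)) (Rle_abs (- f s)).
    rewrite (Rabs_Ropp (f s)). lra. }
  assert (HFo : forall t, is_derive (fun t => - F t) t (- f t)).
  { intros s. apply (is_derive_opp F), HF. }
  assert (Hrev : forall F f : R -> R, (forall t, is_derive F t (f t)) ->
            forall t, is_derive (fun t => F (- t)) t (- f (- t))).
  { intros G g HG s. auto_derive.
    - eexists; apply HG.
    - rewrite (Derive_of_is_derive G (- s) (g (- s))) by apply HG. ring. }
  apply Rabs_le. destruct (Rle_or_lt 0 t) as [Ht|Ht].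
  - assert (H1 := primitive_exp_bound_pos F f A K HK HF F0
                    (fun s => proj1 (Hf2 s)) HA t Ht).
    assert (H2 := primitive_exp_bound_pos (fun t => - F t) _ A K HK HFo
                    ltac:(simpl; rewrite F0; ring) (fun s => proj2 (Hf2 s)) HA t Ht).
    simpl in H2. lra.
  - assert (H1 := primitive_exp_bound_pos _ _ A K HK (Hrev _ _ HF)
                    ltac:(simpl; rewrite Ropp_0; exact F0)
                    ltac:(intros s; rewrite <- (Rabs_Ropp s); apply Hf2) HA (- t) ltac:(lra)).
    assert (H2 := primitive_exp_bound_pos _ _ A K HK (Hrev _ _ HFo)
                    ltac:(simpl; rewrite Ropp_0, F0; ring)
                    ltac:(intros s; rewrite <- (Rabs_Ropp s), Ropp_involutive; apply Hf2)
                    HA (- t) ltac:(lra)).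
    simpl in H1, H2. rewrite Ropp_involutive in H1, H2. rewrite Rabs_Ropp in H1, H2. lra.
Qed.

(** Banach's fixed-point theorem for continuous functions on the line and the
    norm [sup |u| / W].  The weight is locally bounded, so convergence is
    locally uniform, which is enough for the continuity of the limit. *)
Lemma weighted_contraction_fixed_point
  (T : (R -> R) -> R -> R) (W : R -> R) (A0 : R) :
  (forall t, 0 < W t) -> (forall t, continuous W t) ->
  (forall u, (forall t, continuous u t) -> forall t, continuous (T u) t) ->
  (forall u w A, (forall t, continuous u t) -> (forall t, continuous w t) ->
     (forall t, Rabs (u t - w t) <= A * W t) ->
     forall t, Rabs (T u t - T w t) <= A / 2 * W t) ->
  (forall t, Rabs (T (fun _ => 0) t - 0) <= A0 * W t) ->
  exists u, (forall t, continuous u t) /\ forall t, T u t = u t.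
Proof.
  intros HW CW CT LT HT0.
  set (u := fix u n : R -> R := match n with O => fun _ => 0 | S m => T (u m) end).
  assert (Cu : forall n t, continuous (u n) t).
  { induction n as [|n IH]; simpl; [intros; apply continuous_const|apply CT, IH]. }
  assert (Hstep : forall n t, Rabs (u (S n) t - u n t) <= A0 * (1 / 2) ^ n * W t).
  { induction n as [|n IH]; intros t.
    - simpl. rewrite Rmult_1_r. apply HT0.
    - replace (A0 * (1 / 2) ^ S n) with (A0 * (1 / 2) ^ n / 2) by (simpl; field).
      apply LT; auto. }
  assert (HA0 : 0 <= A0).
  { generalize (HT0 0) (Rabs_pos (T (fun _ => 0) 0 - 0)) (HW 0). nra. }
  assert (Hpow : forall n, 0 < (1 / 2) ^ n) by (intros; apply pow_lt; lra).
  (* The factor [1 - (1 / 2) ^ k] makes the geometric sum provable by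
     induction on [k]. *)
  assert (Hfar : forall n k t,
            Rabs (u (n + k)%nat t - u n t)
            <= 2 * A0 * (1 / 2) ^ n * (1 - (1 / 2) ^ k) * W t).
  { intros n k t. induction k as [|k IH].
    - rewrite Nat.add_0_r, Rminus_diag, Rabs_R0. simpl. lra.
    - rewrite Nat.add_succ_r.
      replace (u (S (n + k)) t - u n t)
        with ((u (S (n + k)%nat) t - u (n + k)%nat t) + (u (n + k)%nat t - u n t)) by ring.
      eapply Rle_trans; [apply Rabs_triang|].
      eapply Rle_trans; [apply Rplus_le_compat; [apply Hstep|apply IH]|].
      rewrite pow_add. simpl. right. field. }
  assert (Hfar' : forall n m t, (n <= m)%nat ->
            Rabs (u m t - u n t) <= 2 * A0 * (1 / 2) ^ n * W t).
  { intros n m t Hnm. replace m with (n + (m - n))%nat by lia.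
    eapply Rle_trans; [apply Hfar|].
    assert (0 <= 2 * A0 * (1 / 2) ^ n * W t)
      by (repeat apply Rmult_le_pos; try lra; [apply Rlt_le, Hpow|apply Rlt_le, HW]).
    generalize (Hpow (m - n)%nat). nra. }
  assert (Hsmall : forall B eps, 0 < eps -> exists N, B * (1 / 2) ^ N < eps).
  { intros B eps He.
    destruct (pow_lt_1_zero (1 / 2) ltac:(rewrite Rabs_pos_eq; lra)
                (eps / (Rabs B + 1))) as [N HN].
    { apply Rdiv_lt_0_compat; generalize (Rabs_pos B); lra. }
    exists N. specialize (HN N (le_n N)). rewrite Rabs_pos_eq in HN by apply Rlt_le, Hpow.
    apply Rlt_div_r in HN; [|generalize (Rabs_pos B); lra].
    generalize (Rle_abs B) (Hpow N). nra. }
  assert (Hcv : forall t, exists l : R, is_lim_seq (fun n => u n t) l).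
  { intros t. destruct (proj2 (ex_lim_seq_cauchy_corr (fun n => u n t))) as [l Hl];
      [|exists l; exact Hl].
    intros eps.
    destruct (Hsmall (2 * (2 * A0 * W t)) eps (cond_pos eps)) as [N HN].
    exists N. intros n m Hn Hm.
    replace (u n t - u m t) with ((u n t - u N t) - (u m t - u N t)) by ring.
    eapply Rle_lt_trans; [apply Rabs_triang|]. rewrite Rabs_Ropp.
    generalize (Hfar' N n t Hn) (Hfar' N m t Hm). lra. }
  set (w := fun t => proj1_sig (constructive_indefinite_description _ (Hcv t))).
  assert (Hw : forall t, is_lim_seq (fun n => u n t) (w t)).
  { intros t. unfold w. now destruct (constructive_indefinite_description _ (Hcv t)). }
  assert (Hclose : forall n t, Rabs (w t - u n t) <= 2 * A0 * (1 / 2) ^ n * W t).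
  { intros n t.
    apply (is_lim_seq_le_loc (fun m => Rabs (u m t - u n t))
             (fun _ => 2 * A0 * (1 / 2) ^ n * W t)
             (Rabs (w t - u n t)) (2 * A0 * (1 / 2) ^ n * W t)).
    - exists n. intros m Hm. apply Hfar', Hm.
    - apply (is_lim_seq_abs _ (Finite (w t - u n t))).
      apply is_lim_seq_minus'; [apply Hw|apply is_lim_seq_const].
    - apply is_lim_seq_const. }
  assert (Cw : forall t, continuous w t).
  { intros t. apply continuity_pt_filterlim.
    intros eps He.
    assert (HWt := HW t).
    destruct (Hsmall (2 * A0 * (W t + 1)) (eps / 3) ltac:(lra)) as [N HN].
    assert (CN : continuity_pt (u N) t) by apply continuity_pt_filterlim, Cu.
    assert (CWt : continuity_pt W t) by apply continuity_pt_filterlim, CW.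
    destruct (CN (eps / 3) ltac:(lra)) as [d1 [Hd1 B1]].
    destruct (CWt 1 ltac:(lra)) as [d2 [Hd2 B2]].
    exists (Rmin d1 d2). split; [now apply Rmin_glb_lt|].
    intros s [Ds Hs].
    specialize (B1 s (conj Ds (Rlt_le_trans _ _ _ Hs (Rmin_l _ _)))).
    specialize (B2 s (conj Ds (Rlt_le_trans _ _ _ Hs (Rmin_r _ _)))).
    simpl in B1, B2 |- *. unfold Rdist in B1, B2 |- *.
    apply Rabs_def2 in B2.
    replace (w s - w t) with ((w s - u N s) + (u N s - u N t) - (w t - u N t)) by ring.
    eapply Rle_lt_trans; [apply Rabs_triang|]. rewrite Rabs_Ropp.
    eapply Rle_lt_trans; [apply Rplus_le_compat_r, Rabs_triang|].
    assert (HP : 0 <= 2 * A0 * (1 / 2) ^ N)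
      by (repeat apply Rmult_le_pos; try lra; apply Rlt_le, Hpow).
    generalize (Hclose N s) (Hclose N t). nra. }
  exists w. split; [exact Cw|]. intros t.
  apply Rminus_diag_uniq.
  destruct (Req_dec (T w t - w t) 0) as [E|E]; [exact E|exfalso].
  assert (Hpos := Rabs_pos_lt _ E).
  destruct (Hsmall (2 * (A0 * W t)) _ Hpos) as [N HN].
  assert (HT : Rabs (T w t - u (S N) t) <= 2 * A0 * (1 / 2) ^ N / 2 * W t).
  { apply (LT w (u N)); auto. }
  assert (HSN := Hclose (S N) t).
  replace (T w t - w t) with ((T w t - u (S N) t) - (w t - u (S N) t)) in HN by ring.
  apply (Rlt_not_le _ _ HN).
  eapply Rle_trans; [apply Rabs_triang|]. rewrite Rabs_Ropp. simpl in HSN, HT |- *. lra.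
Qed.

Definition lipschitz2 (G : R -> R -> R) (L : R) : Prop :=
  forall x v y w, Rabs (G x v - G y w) <= L * (Rabs (x - y) + Rabs (v - w)).

(** The equation [x'' = h t + G x x'] as a system.  The forcing is kept apart
    because it only has to be continuous and bounded, whereas [G] is
    Lipschitz. *)
Definition phase_orbit (h : R -> R) (G : R -> R -> R) (x v : R -> R) : Prop :=
  forall t, is_derive x t (v t) /\ is_derive v t (h t + G (x t) (v t)).

Lemma lipschitz2_continuous_comp (G : R -> R -> R) (L : R) (x v : R -> R) (t : R) :
  0 <= L -> lipschitz2 G L -> continuous x t -> continuous v t ->
  continuous (fun s => G (x s) (v s)) t.
Proof.
  intros HL HG Cx Cv. apply continuity_pt_filterlim.
  apply continuity_pt_filterlim in Cx. apply continuity_pt_filterlim in Cv.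
  intros eps He.
  assert (He' : 0 < eps / (2 * (L + 1))) by (apply Rdiv_lt_0_compat; lra).
  destruct (Cx _ He') as [d1 [Hd1 B1]]. destruct (Cv _ He') as [d2 [Hd2 B2]].
  exists (Rmin d1 d2). split; [now apply Rmin_glb_lt|].
  intros s [Ds Hs].
  specialize (B1 s (conj Ds (Rlt_le_trans _ _ _ Hs (Rmin_l _ _)))).
  specialize (B2 s (conj Ds (Rlt_le_trans _ _ _ Hs (Rmin_r _ _)))).
  simpl in B1, B2 |- *. unfold Rdist in B1, B2 |- *.
  eapply Rle_lt_trans; [apply HG|].
  assert (E : eps = (L + 1) * (2 * (eps / (2 * (L + 1))))) by (field; lra).
  generalize (Rabs_pos (x s - x t)) (Rabs_pos (v s - v t)). nra.
Qed.

(** Global existence, by contraction on the velocity alone: the position is its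
    primitive. *)
Theorem phase_orbit_exists (h : R -> R) (G : R -> R -> R) (L B x0 v0 : R) :
  0 <= L -> lipschitz2 G L ->
  (forall t, continuous h t) -> (forall t, Rabs (h t) <= B) ->
  exists x v, phase_orbit h G x v /\ x 0 = x0 /\ v 0 = v0.
Proof.
  intros HL HG Ch Bh.
  set (pos := fun (v : R -> R) t => x0 + RInt v 0 t).
  set (acc := fun (v : R -> R) t => h t + G (pos v t) (v t)).
  set (T := fun (v : R -> R) t => v0 + RInt (acc v) 0 t).
  (* [K >= 1] bounds [|t|] and the position by the weight; [K >= 4 L] makes
     the ratio of the contraction at most [2 L / K <= 1 / 2]. *)
  set (K := 4 * L + 1).
  assert (HK : 1 <= K) by (unfold K; lra).
  assert (Dpos : forall v, (forall t, continuous v t) ->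
            forall t, is_derive (pos v) t (v t)).
  { intros v Cv t. unfold pos.
    replace (v t) with (0 + v t) by ring.
    apply (is_derive_plus (fun _ => x0)); [apply (is_derive_const x0)|].
    now apply is_derive_primitive. }
  assert (Cacc : forall v, (forall t, continuous v t) -> forall t, continuous (acc v) t).
  { intros v Cv t. apply (continuous_plus h); [apply Ch|].
    apply (lipschitz2_continuous_comp G L); auto.
    apply (ex_derive_continuous (pos v)). eexists; apply Dpos, Cv. }
  assert (DT : forall v, (forall t, continuous v t) ->
            forall t, is_derive (T v) t (acc v t)).
  { intros v Cv t. unfold T.
    replace (acc v t) with (0 + acc v t) by ring.
    apply (is_derive_plus (fun _ => v0)); [apply (is_derive_const v0)|].
    apply is_derive_primitive. auto. }
  assert (pos0 : forall v, pos v 0 = x0).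
  { intros v. unfold pos. rewrite RInt_point. unfold zero; simpl. ring. }
  assert (T0 : forall v, T v 0 = v0).
  { intros v. unfold T. rewrite RInt_point. unfold zero; simpl. ring. }
  assert (Dminus : forall F f F' f' : R -> R,
            (forall t, is_derive F t (f t)) -> (forall t, is_derive F' t (f' t)) ->
            forall t, is_derive (fun t => F t - F' t) t (f t - f' t)).
  { intros. apply (is_derive_minus F F'); auto. }
  assert (Hexp : forall t, 1 <= exp (K * Rabs t) /\ Rabs t <= exp (K * Rabs t)).
  { intros t. assert (Ht := Rabs_pos t).
    assert (H := exp_ineq1_le (K * Rabs t)). nra. }
  destruct (weighted_contraction_fixed_point T (fun t => exp (K * Rabs t))
              (Rabs v0 + (B + Rabs (G x0 0)))) as [v [Cv Fv]].
  - intros; apply exp_pos.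
  - intros t. apply (continuous_comp (fun t => K * Rabs t) exp).
    + apply (continuous_scal_r K Rabs). apply continuous_Rabs.
    + apply continuity_pt_filterlim, derivable_continuous, derivable_exp.
  - intros u Cu t. apply (ex_derive_continuous (T u)). eexists; apply DT, Cu.
  - intros u w A Cu Cw Huw t.
    assert (HA : 0 <= A).
    { generalize (Huw 0) (Rabs_pos (u 0 - w 0)). rewrite Rabs_R0, Rmult_0_r, exp_0. lra. }
    assert (Hpos : forall s, Rabs (pos u s - pos w s) <= A / K * exp (K * Rabs s)).
    { apply (primitive_exp_bound _ (fun s => u s - w s)); try lra; auto.
      rewrite !pos0. ring. }
    assert (Hacc : forall s, Rabs (acc u s - acc w s) <= 2 * L * A * exp (K * Rabs s)).
    { intros s. unfold acc.
      replace (h s + G (pos u s) (u s) - (h s + G (pos w s) (w s)))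
        with (G (pos u s) (u s) - G (pos w s) (w s)) by ring.
      eapply Rle_trans; [apply HG|].
      assert (HAK : A / K <= A).
      { apply Rle_div_l; [lra|]. nra. }
      generalize (Hpos s) (Huw s) (exp_pos (K * Rabs s)). intros.
      assert (A / K * exp (K * Rabs s) <= A * exp (K * Rabs s)) by nra.
      nra. }
    eapply Rle_trans.
    + apply (primitive_exp_bound (fun t => T u t - T w t) (fun s => acc u s - acc w s)
               (2 * L * A) K); try lra; auto. rewrite !T0. ring.
    + apply Rmult_le_compat_r; [apply Rlt_le, exp_pos|].
      apply Rle_div_l; [lra|]. unfold K. nra.
  - intros t. rewrite Rminus_0_r.
    assert (Hacc : forall s, Rabs (acc (fun _ => 0) s) <= B + Rabs (G x0 0)).
    { intros s. unfold acc.
      assert (E : pos (fun _ => 0) s = x0).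
      { unfold pos. rewrite RInt_const. unfold scal; simpl; unfold mult; simpl. ring. }
      rewrite E. eapply Rle_trans; [apply Rabs_triang|].
      generalize (Bh s). lra. }
    assert (H : Rabs (T (fun _ => 0) t - T (fun _ => 0) 0)
                <= (B + Rabs (G x0 0)) * Rabs (t - 0)).
    { apply (bounded_variation _ (acc (fun _ => 0))). intros s _. split; [|apply Hacc].
      apply DT. intros; apply continuous_const. }
    rewrite T0, Rminus_0_r in H.
    replace (T (fun _ => 0) t) with ((T (fun _ => 0) t - v0) + v0) by ring.
    eapply Rle_trans; [apply Rabs_triang|].
    destruct (Hexp t) as [H1 H2].
    generalize (Rabs_pos v0) (Rabs_pos (G x0 0)) (Rabs_pos (h 0)) (Bh 0). intros. nra.
  - exists (pos v), v. split; [|split].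
    + intros t. split; [apply Dpos, Cv|].
      apply (is_derive_ext (T v)); [apply Fv|]. apply DT, Cv.
    + apply pos0.
    + rewrite <- Fv. apply T0.
Qed.

Lemma exp_gronwall (U U' : R -> R) (c : R) :
  (forall t, is_derive U t (U' t)) -> (forall t, Rabs (U' t) <= c * U t) ->
  forall t, U t <= U 0 * exp (c * Rabs t).
Proof.
  intros HU HU' t.
  assert (Hs : forall s t, is_derive (fun t => U t * exp (s * t)) t
                 ((U' t + s * U t) * exp (s * t))).
  { intros s r. auto_derive.
    - eexists; apply HU.
    - rewrite (Derive_of_is_derive U r (U' r)) by apply HU. ring. }
  assert (Hb : forall t, - (c * U t) <= U' t <= c * U t).
  { intros r. apply Rabs_le_between, HU'. }
  destruct (Rle_or_lt 0 t) as [Ht|Ht].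
  - assert (H : - (U 0 * exp (- c * 0)) <= - (U t * exp (- c * t))).
    { apply (derive_nonneg_le (fun t => - (U t * exp (- c * t)))
               (fun t => - ((U' t + - c * U t) * exp (- c * t)))); auto.
      - intros r. apply (is_derive_opp (fun t => U t * exp (- c * t))), Hs.
      - intros r _. generalize (Hb r) (exp_pos (- c * r)). nra. }
    rewrite Rmult_0_r, exp_0, Rmult_1_r in H. rewrite Rabs_pos_eq by lra.
    assert (E : exp (- c * t) * exp (c * t) = 1).
    { rewrite <- exp_plus. replace (- c * t + c * t) with 0 by ring. apply exp_0. }
    replace (U t) with (U t * exp (- c * t) * exp (c * t)) by (rewrite Rmult_assoc, E; ring).
    apply Rmult_le_compat_r; [apply Rlt_le, exp_pos|lra].
  - assert (H : U t * exp (c * t) <= U 0 * exp (c * 0)).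
    { apply (derive_nonneg_le (fun t => U t * exp (c * t))
               (fun t => (U' t + c * U t) * exp (c * t))); auto; try lra.
      intros r _. generalize (Hb r) (exp_pos (c * r)). nra. }
    rewrite Rmult_0_r, exp_0, Rmult_1_r in H. rewrite Rabs_left by lra.
    assert (E : exp (c * - t) * exp (c * t) = 1).
    { rewrite <- exp_plus. replace (c * - t + c * t) with 0 by ring. apply exp_0. }
    replace (U t) with (U t * exp (c * t) * exp (c * - t))
      by (rewrite Rmult_assoc, (Rmult_comm (exp (c * t))), E; ring).
    apply Rmult_le_compat_r; [apply Rlt_le, exp_pos|lra].
Qed.


(** Lipschitz dependence on the initial data, by Gronwall's inequality for the
    squared distance of two orbits.  It contains uniqueness. *)
Theorem phase_orbit_dependence (h : R -> R) (G : R -> R -> R) (L : R)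
  (x v y w : R -> R) :
  0 <= L -> lipschitz2 G L -> phase_orbit h G x v -> phase_orbit h G y w ->
  forall t, let C := exp ((1 + 3 * L) / 2 * Rabs t) in
    Rabs (x t - y t) <= C * (Rabs (x 0 - y 0) + Rabs (v 0 - w 0)) /\
    Rabs (v t - w t) <= C * (Rabs (x 0 - y 0) + Rabs (v 0 - w 0)).
Proof.
  intros HL HG Hxv Hyw t C.
  set (U := fun t => (x t - y t) ^ 2 + (v t - w t) ^ 2).
  set (dG := fun t => G (x t) (v t) - G (y t) (w t)).
  assert (HU : U t <= U 0 * exp ((1 + 3 * L) * Rabs t)).
  { apply (exp_gronwall U (fun t => 2 * ((x t - y t) * (v t - w t) + (v t - w t) * dG t))).
    - intros s. unfold U, dG.
      destruct (Hxv s) as [Dx Dv], (Hyw s) as [Dy Dw].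
      auto_derive.
      + repeat split; eexists; eassumption.
      + rewrite (Derive_of_is_derive _ _ _ Dx), (Derive_of_is_derive _ _ _ Dv),
          (Derive_of_is_derive _ _ _ Dy), (Derive_of_is_derive _ _ _ Dw). ring.
    - intros s. unfold U.
      assert (Hd : Rabs (dG s) <= L * (Rabs (x s - y s) + Rabs (v s - w s))) by apply HG.
      rewrite Rabs_mult, (Rabs_pos_eq 2) by lra.
      rewrite <- (pow2_abs (x s - y s)), <- (pow2_abs (v s - w s)).
      eapply Rle_trans; [apply Rmult_le_compat_l; [lra|apply Rabs_triang]|].
      rewrite !Rabs_mult.
      generalize dependent (Rabs (dG s)). intros z Hz.
      set (a := Rabs (x s - y s)) in *. set (b := Rabs (v s - w s)) in *.
      assert (0 <= b) by apply Rabs_pos.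
      assert (b * z <= b * (L * (a + b))) by (apply Rmult_le_compat_l; auto).
      assert (0 <= (1 + L) * (a - b) ^ 2)
        by (apply Rmult_le_pos; [lra|apply pow2_ge_0]).
      assert (0 <= L * a ^ 2) by (apply Rmult_le_pos; [lra|apply pow2_ge_0]).
      nra. }
  assert (HC : C * C = exp ((1 + 3 * L) * Rabs t)).
  { unfold C. rewrite <- exp_plus. f_equal. field. }
  assert (HC0 : 0 < C) by apply exp_pos.
  rewrite <- HC in HU. unfold U in HU.
  set (a := Rabs (x 0 - y 0)). set (b := Rabs (v 0 - w 0)).
  assert (Ha : 0 <= a) by apply Rabs_pos. assert (Hb : 0 <= b) by apply Rabs_pos.
  rewrite <- (pow2_abs (x 0 - y 0)), <- (pow2_abs (v 0 - w 0)) in HU.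
  fold a b in HU.
  assert (Hsq : (x t - y t) ^ 2 + (v t - w t) ^ 2 <= (C * (a + b)) ^ 2).
  { eapply Rle_trans; [exact HU|].
    assert (0 <= C * C * (2 * a * b)) by (repeat apply Rmult_le_pos; lra). nra. }
  assert (H0 : 0 <= C * (a + b)) by (apply Rmult_le_pos; lra).
  assert (Habs : forall z, z ^ 2 <= (C * (a + b)) ^ 2 -> Rabs z <= C * (a + b)).
  { intros z Hz. rewrite <- (Rabs_pos_eq (C * (a + b))) by exact H0.
    apply Rsqr_le_abs_0. rewrite !Rsqr_pow2. exact Hz. }
  split; apply Habs; [generalize (pow2_ge_0 (v t - w t))|generalize (pow2_ge_0 (x t - y t))]; lra.
Qed.

(** * Periodic functions and their primitives *)

Lemma periodic_shift_Z (p : R) (f : R -> R) (k : Z) (t : R) :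
  periodic p f -> f (t + IZR k * p) = f t.
Proof.
  intros Hf.
  assert (Hn : forall n s, f (s + INR n * p) = f s).
  { induction n as [|n IH]; intros s.
    - f_equal. simpl. ring.
    - rewrite <- (IH s), <- (Hf (s + INR n * p)). f_equal. rewrite S_INR. ring. }
  destruct (Z.le_gt_cases 0 k) as [Hk|Hk].
  - rewrite <- (Z2Nat.id k) by lia. rewrite <- INR_IZR_INZ. apply Hn.
  - rewrite <- (Hn (Z.to_nat (- k)) (t + IZR k * p)). f_equal.
    rewrite INR_IZR_INZ, Z2Nat.id by lia. rewrite opp_IZR. ring.
Qed.

Lemma periodic_continuous_bounded (p : R) (f : R -> R) :
  0 < p -> periodic p f -> (forall t, continuous f t) ->
  exists K, forall t, Rabs (f t) <= K.
Proof.
  intros Hp Hf Cf.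
  destruct (continuity_ab_maj (fun t => Rabs (f t)) 0 p) as [m [Hm _]]; [lra| |].
  - intros c _. apply continuity_pt_filterlim.
    apply (continuous_comp f Rabs); [apply Cf|apply continuous_Rabs].
  - exists (Rabs (f m)). intros t.
    set (k := Int_part (t / p)).
    rewrite <- (periodic_shift_Z p f (- k) t Hf). apply Hm.
    destruct (base_Int_part (t / p)) as [H1 H2]. fold k in H1, H2.
    rewrite opp_IZR.
    assert (E : t = t / p * p) by (field; lra).
    split; rewrite E at 1; nra.
Qed.

Lemma primitive_periodic (p : R) (e : R -> R) :
  (forall t, continuous e t) -> periodic p e -> RInt e 0 p = 0 ->
  periodic p (fun t => RInt e 0 t).
Proof.
  intros Ce Pe He t.
  assert (Ie : forall a b, ex_RInt e a b).
  { intros; apply (ex_RInt_continuous (V := R_CompleteNormedModule)); intros; apply Ce. }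
  rewrite <- (RInt_Chasles e 0 p (t + p)) by apply Ie.
  rewrite He. unfold plus; simpl. rewrite Rplus_0_l.
  assert (E : RInt e (1 * 0 + p) (1 * t + p) = RInt e 0 t).
  { rewrite <- (RInt_comp_lin e 1 p 0 t) by apply Ie.
    apply RInt_ext. intros s _. unfold scal; simpl; unfold mult; simpl.
    rewrite !Rmult_1_l. apply Pe. }
  rewrite Rmult_0_r, Rplus_0_l, Rmult_1_l in E. exact E.
Qed.

(** * The damped equation and its unbounded solutions *)

Definition damped (lam : R) (g : R -> R) (x v : R) : R := - lam * v - g x.

Lemma is_solution_phase_orbit (lam mu : R) (g e x : R -> R) :
  is_solution lam mu g e x ->
  phase_orbit (fun t => mu + e t) (damped lam g) x (Derive x).
Proof.
  intros Hx t. destruct (Hx t) as (D1 & D2 & E). split.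
  - now apply Derive_correct.
  - unfold damped.
    replace (mu + e t + (- lam * Derive x t - g (x t))) with (Derive (Derive x) t) by lra.
    now apply Derive_correct.
Qed.

Lemma phase_orbit_is_solution (lam mu : R) (g e x v : R -> R) :
  phase_orbit (fun t => mu + e t) (damped lam g) x v -> is_solution lam mu g e x.
Proof.
  intros Hxv t.
  assert (Dx : forall s, Derive x s = v s) by (intros; apply is_derive_unique, Hxv).
  assert (Dv : is_derive (Derive x) t (mu + e t + damped lam g (x t) (v t))).
  { apply (is_derive_ext v); [intros; symmetry; apply Dx|apply Hxv]. }
  split; [eexists; apply Hxv|]. split; [eexists; exact Dv|].
  rewrite (is_derive_unique _ _ _ Dv), Dx. unfold damped. ring.
Qed.

(** The reflection [x -> - x] exchanges the two ends of the range of [g], so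
    that one-sided estimates need be proved for one side only. *)
Lemma phase_orbit_opp (lam : R) (h g x v : R -> R) :
  phase_orbit h (damped lam g) x v ->
  phase_orbit (fun t => - h t) (damped lam (fun y => - g (- y)))
    (fun t => - x t) (fun t => - v t).
Proof.
  intros Hxv t. destruct (Hxv t) as [Dx Dv]. split.
  - now apply (is_derive_opp x).
  - replace (- h t + damped lam (fun y => - g (- y)) (- x t) (- v t))
      with (- (h t + damped lam g (x t) (v t)))
      by (unfold damped; rewrite Ropp_involutive; ring).
    now apply (is_derive_opp v).
Qed.

Lemma is_derive_reflect (f : R -> R) (t l : R) :
  is_derive f (- t) l -> is_derive (fun s => f (- s)) t (- l).
Proof.
  intros Hf. auto_derive.
  - eexists; exact Hf.
  - rewrite (Derive_of_is_derive _ _ _ Hf). ring.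
Qed.

(** Carries statements about the future over to the past, at the cost of
    replacing damping by anti-damping. *)
Lemma phase_orbit_reverse (lam : R) (h g x v : R -> R) :
  phase_orbit h (damped lam g) x v ->
  phase_orbit (fun t => h (- t)) (damped (- lam) g)
    (fun t => x (- t)) (fun t => - v (- t)).
Proof.
  intros Hxv t. destruct (Hxv (- t)) as [Dx Dv]. split.
  - now apply is_derive_reflect.
  - replace (h (- t) + damped (- lam) g (x (- t)) (- v (- t)))
      with (- - (h (- t) + damped lam g (x (- t)) (v (- t))))
      by (unfold damped; ring).
    apply (is_derive_opp (fun s => v (- s))). now apply is_derive_reflect.
Qed.

(** The momentum [x' + lam x], corrected by the primitive of the periodic
    forcing, is driven by the excess [mu - g x] alone. *)
Lemma is_derive_momentum (lam mu : R) (e E g x v : R -> R) (t : R) :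
  (forall t, is_derive E t (e t)) ->
  phase_orbit (fun t => mu + e t) (damped lam g) x v ->
  is_derive (fun t => v t + lam * x t - E t) t (mu - g (x t)).
Proof.
  intros HE Hxv. destruct (Hxv t) as [Dx Dv].
  auto_derive.
  - split; [eexists; exact Dv|]. split; [eexists; exact Dx|].
    split; [eexists; apply HE|exact I].
  - rewrite (Derive_of_is_derive _ _ _ Dx), (Derive_of_is_derive _ _ _ Dv),
      (Derive_of_is_derive _ _ _ (HE t)). unfold damped. ring.
Qed.

(** As long as [x] is bounded, [mu - g x >= dl > 0]: the momentum grows
    linearly, hence so does [x'], and [x] grows quadratically.  Time
    reversal turns [lam] into [- lam], hence a statement for both signs. *)
Lemma excess_forcing_unbounded (lam mu KE : R) (e E g x v : R -> R) :
  (forall t, is_derive E t (e t)) -> (forall t, Rabs (E t) <= KE) ->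
  (forall y, continuous g y) -> (forall y, g y < mu) ->
  phase_orbit (fun t => mu + e t) (damped lam g) x v ->
  unbounded_at_p_infty x.
Proof.
  intros HE BE Cg Hg Hxv [K HK].
  assert (HK0 : 0 <= K).
  { generalize (HK 0 (Rle_refl 0)) (Rabs_pos (x 0)). lra. }
  destruct (continuity_ab_maj g (- K) K) as [ym [Hym _]]; [lra| |].
  { intros; apply continuity_pt_filterlim, Cg. }
  set (dl := mu - g ym).
  assert (Hdl : 0 < dl) by (unfold dl; specialize (Hg ym); lra).
  set (a := v 0 + lam * x 0 - E 0 - KE - Rabs lam * K).
  assert (Hv : forall t, 0 <= t -> a + dl * t <= v t).
  { intros t Ht.
    assert (H : v 0 + lam * x 0 - E 0 - dl * 0 <= v t + lam * x t - E t - dl * t).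
    { apply (derive_nonneg_le (fun t => v t + lam * x t - E t - dl * t)
               (fun t => mu - g (x t) - dl)); auto.
      - intros s. apply (is_derive_minus (fun t => v t + lam * x t - E t) (fun t => dl * t)).
        + now apply is_derive_momentum with (e := e).
        + auto_derive; auto. ring.
      - intros s Hs. specialize (HK s (proj1 Hs)). apply Rabs_le_between in HK.
        specialize (Hym (x s) HK). unfold dl. lra. }
    assert (Hlx : Rabs (lam * x t) <= Rabs lam * K).
    { rewrite Rabs_mult. apply Rmult_le_compat_l; [apply Rabs_pos|now apply HK]. }
    apply Rabs_le_between in Hlx.
    assert (HEt := BE t). apply Rabs_le_between in HEt.
    unfold a. lra. }
  (* At this time [a t + dl t ^ 2 / 2 >= 1 + 2 K], more than the oscillation
     that the bound [K] allows. *)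
  set (t := 2 * (Rabs a + 1 + 2 * K) / dl + 1).
  assert (Ht1 : 0 <= 2 * (Rabs a + 1 + 2 * K) / dl).
  { apply Rdiv_le_0_compat; [generalize (Rabs_pos a); lra|exact Hdl]. }
  assert (Ht : 1 <= t) by (unfold t; lra).
  assert (Hdt : dl * t / 2 = Rabs a + 1 + 2 * K + dl / 2) by (unfold t; field; lra).
  assert (H : x 0 - a * 0 - dl * 0 ^ 2 / 2 <= x t - a * t - dl * t ^ 2 / 2).
  { apply (derive_nonneg_le (fun t => x t - a * t - dl * t ^ 2 / 2)
             (fun t => v t - a - dl * t)); try lra.
    - intros s. auto_derive.
      + eexists; apply Hxv.
      + rewrite (Derive_of_is_derive _ _ _ (proj1 (Hxv s))). field.
    - intros s Hs. generalize (Hv s (proj1 Hs)). lra. }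
  assert (H0 := HK 0 (Rle_refl 0)). assert (Hxt := HK t ltac:(lra)).
  apply Rabs_le_between in H0. apply Rabs_le_between in Hxt.
  assert (Ha := Rle_abs (- a)). rewrite Rabs_Ropp in Ha.
  assert (1 + 2 * K <= a + dl * t / 2) by lra.
  assert (1 * (1 + 2 * K) <= t * (a + dl * t / 2)) by (apply Rmult_le_compat; lra).
  nra.
Qed.

Lemma excess_forcing_unbounded_both (lam mu KE : R) (e E g x v : R -> R) :
  (forall t, is_derive E t (e t)) -> (forall t, Rabs (E t) <= KE) ->
  (forall y, continuous g y) -> (forall y, g y < mu) ->
  phase_orbit (fun t => mu + e t) (damped lam g) x v ->
  unbounded_at_p_infty x /\ unbounded_at_m_infty x.
Proof.
  intros HE BE Cg Hg Hxv. split.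
  - now apply (excess_forcing_unbounded lam mu KE e E g x v).
  - intros [K HK].
    apply (excess_forcing_unbounded (- lam) mu KE (fun t => e (- t)) (fun t => - E (- t))
             g (fun t => x (- t)) (fun t => - v (- t))); auto.
    + intros t. rewrite <- (Ropp_involutive (e (- t))).
      apply (is_derive_opp (fun s => E (- s))). now apply is_derive_reflect.
    + intros t. rewrite Rabs_Ropp. apply BE.
    + now apply (phase_orbit_reverse lam (fun t => mu + e t)).
    + exists K. intros t Ht. apply HK. lra.
Qed.

Lemma unbounded_on_opp (D : R -> Prop) (x : R -> R) :
  unbounded_on D (fun t => - x t) -> unbounded_on D x.
Proof.
  intros H [K HK]. apply H. exists K. intros t Ht. rewrite Rabs_Ropp. auto.
Qed.

(** * Periodic solutions *)

(** Damping confines the velocity: [(x' - V) exp (lam t)] decreases as soon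
    as the force [h - g x] stays below [lam V]. *)
Lemma velocity_lt (lam V : R) (h g x v : R -> R) :
  phase_orbit h (damped lam g) x v ->
  (forall t, h t - g (x t) < lam * V) -> v 0 <= V ->
  forall t, 0 < t -> v t < V.
Proof.
  intros Hxv HV H0 t Ht.
  assert (H : (V - v 0) * exp (lam * 0) < (V - v t) * exp (lam * t)).
  { apply (derive_pos_lt (fun t => (V - v t) * exp (lam * t))
             (fun t => (lam * V - (h t - g (x t))) * exp (lam * t))); auto.
    - intros s. auto_derive.
      + eexists; apply Hxv.
      + rewrite (Derive_of_is_derive _ _ _ (proj2 (Hxv s))). unfold damped. ring.
    - intros s _. apply Rmult_lt_0_compat; [specialize (HV s); lra|apply exp_pos]. }
  rewrite Rmult_0_r, exp_0, Rmult_1_r in H.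
  generalize (exp_pos (lam * t)). nra.
Qed.

Lemma velocity_confined (lam V : R) (h g x v : R -> R) :
  phase_orbit h (damped lam g) x v ->
  (forall t, Rabs (h t - g (x t)) < lam * V) -> Rabs (v 0) <= V ->
  forall t, 0 < t -> - V < v t < V.
Proof.
  intros Hxv HV H0 t Ht. apply Rabs_le_between in H0. split.
  - assert (H := velocity_lt lam V _ _ _ _ (phase_orbit_opp _ _ _ _ _ Hxv)).
    simpl in H. enough (- v t < V) by lra. apply H; try lra.
    intros s. rewrite Ropp_involutive.
    generalize (Rabs_def2 _ _ (HV s)). lra.
  - apply (velocity_lt lam V h g x v); auto; try lra.
    intros s. generalize (Rabs_def2 _ _ (HV s)). lra.
Qed.

Lemma momentum_decreases (lam mu p : R) (e E g x v : R -> R) :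
  0 < p -> (forall t, is_derive E t (e t)) -> E p = E 0 ->
  phase_orbit (fun t => mu + e t) (damped lam g) x v ->
  (forall t, 0 <= t <= p -> mu < g (x t)) ->
  v p + lam * x p < v 0 + lam * x 0.
Proof.
  intros Hp HE Ep Hxv Hg.
  assert (H : - (v 0 + lam * x 0 - E 0) < - (v p + lam * x p - E p)).
  { apply (derive_pos_lt (fun t => - (v t + lam * x t - E t))
             (fun t => - (mu - g (x t)))); auto.
    - intros t. apply (is_derive_opp (fun t => v t + lam * x t - E t)).
      now apply is_derive_momentum with (e := e).
    - intros t Ht. generalize (Hg t Ht). lra. }
  lra.
Qed.

Lemma momentum_increases (lam mu p : R) (e E g x v : R -> R) :
  0 < p -> (forall t, is_derive E t (e t)) -> E p = E 0 ->
  phase_orbit (fun t => mu + e t) (damped lam g) x v ->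
  (forall t, 0 <= t <= p -> g (x t) < mu) ->
  v 0 + lam * x 0 < v p + lam * x p.
Proof.
  intros Hp HE Ep Hxv Hg.
  assert (H : - v p + lam * - x p < - v 0 + lam * - x 0).
  { apply (momentum_decreases lam (- mu) p (fun t => - e t) (fun t => - E t)
             (fun y => - g (- y)) (fun t => - x t) (fun t => - v t)); auto.
    - intros t. now apply (is_derive_opp E).
    - rewrite Ep. reflexivity.
    - intros t. destruct (phase_orbit_opp _ _ _ _ _ Hxv t) as [D1 D2].
      split; [exact D1|]. now rewrite <- Ropp_plus_distr.
    - intros t Ht. rewrite Ropp_involutive. generalize (Hg t Ht). lra. }
  lra.
Qed.

Lemma displacement_le (V p : R) (h : R -> R) (G : R -> R -> R) (x v : R -> R) (t : R) :
  phase_orbit h G x v -> (forall t, 0 <= t <= p -> - V <= v t <= V) ->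
  0 <= V -> 0 <= t <= p -> x 0 - V * p <= x t <= x 0 + V * p.
Proof.
  intros Hxv Hv HV Ht.
  assert (H1 : x 0 + V * 0 <= x t + V * t).
  { apply (derive_nonneg_le (fun t => x t + V * t) (fun t => v t + V)); try lra.
    - intros s. auto_derive. 1: eexists; apply Hxv.
      rewrite (Derive_of_is_derive _ _ _ (proj1 (Hxv s))). ring.
    - intros s Hs. generalize (Hv s ltac:(lra)). lra. }
  assert (H2 : V * 0 - x 0 <= V * t - x t).
  { apply (derive_nonneg_le (fun t => V * t - x t) (fun t => V - v t)); try lra.
    - intros s. auto_derive. 1: eexists; apply Hxv.
      rewrite (Derive_of_is_derive _ _ _ (proj1 (Hxv s))). ring.
    - intros s Hs. generalize (Hv s ltac:(lra)). lra. }
  nra.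
Qed.

Lemma lipschitz_continuity_2d (f : R -> R -> R) (C : R) :
  0 <= C ->
  (forall u v u' v', Rabs (f u v - f u' v') <= C * (Rabs (u - u') + Rabs (v - v'))) ->
  forall u v, continuity_2d_pt f u v.
Proof.
  intros HC Hf u v eps.
  assert (Hd : 0 < eps / (2 * (C + 1))).
  { apply Rdiv_lt_0_compat; [apply cond_pos|lra]. }
  exists (mkposreal _ Hd). simpl. intros x y Hx Hy.
  eapply Rle_lt_trans; [apply Hf|].
  assert (E : pos eps = (C + 1) * (2 * (eps / (2 * (C + 1))))) by (field; lra).
  generalize (Rabs_pos (x - u)) (Rabs_pos (y - v)). nra.
Qed.

(** An orbit that returns to its initial state after one period of the forcing
    is periodic: its translate has the same initial data. *)
Lemma phase_orbit_periodic (h : R -> R) (G : R -> R -> R) (L p : R) (x v : R -> R) :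
  0 <= L -> lipschitz2 G L -> periodic p h -> phase_orbit h G x v ->
  x p = x 0 -> v p = v 0 -> periodic p x.
Proof.
  intros HL HG Ph Hxv Ex Ev t.
  assert (Htr : phase_orbit h G (fun t => x (t + p)) (fun t => v (t + p))).
  { intros s. destruct (Hxv (s + p)) as [Dx Dv]. split.
    - auto_derive; [eexists; exact Dx|].
      rewrite (Derive_of_is_derive _ _ _ Dx). ring.
    - auto_derive; [eexists; exact Dv|].
      rewrite (Derive_of_is_derive _ _ _ Dv), Ph. ring. }
  destruct (phase_orbit_dependence h G L _ _ _ _ HL HG Htr Hxv t) as [H _].
  rewrite Rplus_0_l, Ex, Ev, !Rminus_diag, Rabs_R0, Rplus_0_r, Rmult_0_r in H.
  apply Rminus_diag_uniq. destruct (Req_dec (x (t + p) - x t) 0) as [E|E]; auto.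
  generalize (Rabs_pos_lt _ E). lra.
Qed.

Lemma damped_lipschitz (lam L : R) (g : R -> R) :
  0 <= lam -> 0 <= L -> (forall x y, Rabs (g x - g y) <= L * Rabs (x - y)) ->
  lipschitz2 (damped lam g) (lam + L).
Proof.
  intros Hlam HL Hg x v y w. unfold damped.
  replace (- lam * v - g x - (- lam * w - g y))
    with (- (lam * (v - w)) - (g x - g y)) by ring.
  eapply Rle_trans; [apply Rabs_triang|]. rewrite !Rabs_Ropp, Rabs_mult.
  rewrite (Rabs_pos_eq lam) by exact Hlam.
  generalize (Hg x y) (Rabs_pos (x - y)) (Rabs_pos (v - w)). nra.
Qed.

(** On the box [|x0| <= R0 + V p], [|v0| <= V] of initial data, the variation
    over one period of the velocity points inwards on the horizontal sides, by
    the damping, and so does that of the momentum [x' + lam x] on the vertical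
    sides: an orbit starting there keeps [|x| >= R0] during the period, so
    [g x - mu] keeps the sign of [x].  A common zero of the two variations is
    the initial state of a periodic solution. *)
Theorem periodic_solution_exists (lam mu p M L R0 : R) (e g : R -> R) :
  0 < lam -> 0 < p -> (forall t, continuous e t) -> periodic p e -> RInt e 0 p = 0 ->
  (forall y, Rabs (g y) <= M) ->
  0 <= L -> (forall x y, Rabs (g x - g y) <= L * Rabs (x - y)) ->
  0 <= R0 -> (forall y, R0 <= y -> mu < g y) -> (forall y, y <= - R0 -> g y < mu) ->
  exists x, is_solution lam mu g e x /\ periodic p x.
Proof.
  intros Hlam Hp Ce Pe He HM HL Hg HR0 Hgp Hgm.
  set (h := fun t => mu + e t).
  assert (Ch : forall t, continuous h t).
  { intros t. apply (continuous_plus (fun _ => mu) e); [apply continuous_const|apply Ce]. }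
  assert (Ph : periodic p h) by (intros t; unfold h; now rewrite Pe).
  destruct (periodic_continuous_bounded p h Hp Ph Ch) as [B HB].
  assert (HG := damped_lipschitz lam L g (Rlt_le _ _ Hlam) HL Hg).
  assert (HL' : 0 <= lam + L) by lra.
  set (E := fun t => RInt e 0 t).
  assert (HE : forall t, is_derive E t (e t)) by (intros; now apply is_derive_primitive).
  assert (Ep : E p = E 0).
  { unfold E. rewrite He, RInt_point. reflexivity. }
  assert (Hex : forall x0 v0, exists xv : (R -> R) * (R -> R),
            phase_orbit h (damped lam g) (fst xv) (snd xv)
            /\ fst xv 0 = x0 /\ snd xv 0 = v0).
  { intros x0 v0.
    destruct (phase_orbit_exists h (damped lam g) (lam + L) B x0 v0 HL' HG Ch HB)
      as (x & v & H). now exists (x, v). }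
  set (flow := fun x0 v0 => proj1_sig (constructive_indefinite_description _ (Hex x0 v0))).
  set (X := fun x0 v0 => fst (flow x0 v0)). set (Y := fun x0 v0 => snd (flow x0 v0)).
  assert (HXY : forall x0 v0, phase_orbit h (damped lam g) (X x0 v0) (Y x0 v0)
                  /\ X x0 v0 0 = x0 /\ Y x0 v0 0 = v0).
  { intros x0 v0. unfold X, Y, flow.
    now destruct (constructive_indefinite_description _ (Hex x0 v0)). }
  assert (Cont : (forall u v, continuity_2d_pt (fun u v => X u v p) u v)
                 /\ (forall u v, continuity_2d_pt (fun u v => Y u v p) u v)).
  { split; apply (lipschitz_continuity_2d _ (exp ((1 + 3 * (lam + L)) / 2 * Rabs p)));
      try apply Rlt_le, exp_pos; intros u v u' v';
      destruct (HXY u v) as (O1 & E1 & E2); destruct (HXY u' v') as (O2 & E3 & E4);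
      destruct (phase_orbit_dependence h _ _ _ _ _ _ HL' HG O1 O2 p) as [D1 D2];
      rewrite E1, E2, E3, E4 in D1, D2; assumption. }
  destruct Cont as [CX CY].
  (* The damping at velocity [V] strictly exceeds the force. *)
  set (V := (B + M + 1) / lam).
  assert (HB0 : 0 <= B) by (generalize (HB 0) (Rabs_pos (h 0)); lra).
  assert (HM0 : 0 <= M) by (generalize (HM 0) (Rabs_pos (g 0)); lra).
  assert (HV : 0 < V) by (apply Rdiv_lt_0_compat; lra).
  assert (Hforce : forall t y, Rabs (h t - g y) < lam * V).
  { intros t y. replace (lam * V) with (B + M + 1) by (unfold V; field; lra).
    eapply Rle_lt_trans; [apply Rabs_triang|]. rewrite Rabs_Ropp.
    generalize (HB t) (HM y). lra. }
  assert (Hvel : forall x0 v0, - V <= v0 <= V -> forall t, 0 < t -> - V < Y x0 v0 t < V).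
  { intros x0 v0 Hv0. destruct (HXY x0 v0) as (O & _ & E2).
    apply (velocity_confined lam V h g (X x0 v0)); auto.
    rewrite E2. now apply Rabs_le. }
  assert (Hdisp : forall x0 v0, - V <= v0 <= V -> forall t, 0 <= t <= p ->
            x0 - V * p <= X x0 v0 t <= x0 + V * p).
  { intros x0 v0 Hv0 t Ht. destruct (HXY x0 v0) as (O & E1 & E2).
    assert (D := displacement_le V p h _ _ _ t O). rewrite E1 in D. apply D; try lra.
    intros s Hs. destruct (Req_dec s 0) as [->|Hs0]; [lra|].
    generalize (Hvel x0 v0 Hv0 s ltac:(lra)). lra. }
  assert (HVp : 0 < V * p) by now apply Rmult_lt_0_compat.
  destruct (poincare_miranda_2d
              (fun u v => (v + lam * u) - (Y u v p + lam * X u v p))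
              (fun u v => v - Y u v p)
              (- (R0 + V * p)) (R0 + V * p) (- V) V)
    as (x0 & v0 & _ & _ & Z1 & Z2); try lra.
  - intros u v. apply continuity_2d_pt_minus; apply continuity_2d_pt_plus; auto;
      try apply continuity_2d_pt_mult; auto using continuity_2d_pt_id1,
      continuity_2d_pt_id2, continuity_2d_pt_const.
  - intros u v. apply continuity_2d_pt_minus; auto using continuity_2d_pt_id2.
  - intros v Hv. split.
    + destruct (HXY (- (R0 + V * p)) v) as (O & E1 & E2).
      assert (D := momentum_increases lam mu p e E g _ _ Hp HE Ep O).
      rewrite E1, E2 in D. apply Rlt_minus, D.
      intros t Ht. apply Hgm. generalize (Hdisp (- (R0 + V * p)) v Hv t Ht). lra.
    + destruct (HXY (R0 + V * p) v) as (O & E1 & E2).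
      assert (D := momentum_decreases lam mu p e E g _ _ Hp HE Ep O).
      rewrite E1, E2 in D. apply Rlt_le, Rlt_0_minus, D.
      intros t Ht. apply Hgp. generalize (Hdisp (R0 + V * p) v Hv t Ht). lra.
  - intros u _. generalize (Hvel u (- V) ltac:(lra) p Hp) (Hvel u V ltac:(lra) p Hp). lra.
  - destruct (HXY x0 v0) as (O & E1 & E2).
    exists (X x0 v0). split; [now apply phase_orbit_is_solution with (v := Y x0 v0)|].
    apply (phase_orbit_periodic h (damped lam g) (lam + L) p _ (Y x0 v0)); auto.
    + rewrite E1. assert (Hz : lam * (x0 - X x0 v0 p) = 0) by lra.
      apply Rmult_integral in Hz. lra.
    + rewrite E2. lra.
Qed.

Theorem theorem5p2
  (p lam omega mu : R) (e g : R -> R) (M gminf gpinf : R)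
  (hp : 0 < p) (hlam : 0 < lam) (homega : omega = 2 * PI / p)
  (he_cont : forall t : R, continuous e t)
  (he_per : periodic p e)
  (he_mean : RInt e 0 p = 0)
  (hg_C1 : continuously_differentiable g)
  (hM : 0 < M)
  (hg_bound : forall x : R, Rabs (g x) <= M)
  (hg_deriv : forall x : R, Rabs (Derive g x) < lam ^ 2 / 4 + omega ^ 2)
  (hg_pinf : is_lim g p_infty gpinf)
  (hg_minf : is_lim g m_infty gminf)
  (hg_between : forall x : R, gminf < g x < gpinf) :
  ((exists x : R -> R, is_solution lam mu g e x /\ periodic p x)
     <-> gminf < mu < gpinf)
  /\
  (~ (gminf < mu < gpinf) ->
     forall x : R -> R, is_solution lam mu g e x ->
       unbounded_at_p_infty x /\ unbounded_at_m_infty x).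
Proof.
  assert (Cg : forall y, continuous g y).
  { intros y. apply (ex_derive_continuous g), hg_C1. }
  assert (Hunb : ~ (gminf < mu < gpinf) ->
            forall x : R -> R, is_solution lam mu g e x ->
            unbounded_at_p_infty x /\ unbounded_at_m_infty x).
  { intros Hmu x Hx. apply is_solution_phase_orbit in Hx.
    set (E := fun t => RInt e 0 t).
    assert (HE : forall t, is_derive E t (e t)) by (intros; now apply is_derive_primitive).
    destruct (periodic_continuous_bounded p E hp) as [KE BE].
    { now apply primitive_periodic. }
    { intros t. apply (ex_derive_continuous E). eexists; apply HE. }
    destruct (Rle_or_lt gpinf mu) as [Hhigh|Hlow].
    - apply (excess_forcing_unbounded_both lam mu KE e E g x (Derive x)); auto.
      intros y. generalize (hg_between y). lra.
    - assert (H : unbounded_at_p_infty (fun t => - x t)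
                  /\ unbounded_at_m_infty (fun t => - x t)).
      { apply (excess_forcing_unbounded_both lam (- mu) KE (fun t => - e t)
                 (fun t => - E t) (fun y => - g (- y)) _ (fun t => - Derive x t)).
        - intros t. now apply (is_derive_opp E).
        - intros t. now rewrite Rabs_Ropp.
        - intros y. apply (continuous_opp (fun y => g (- y))).
          apply (continuous_comp Ropp g); [|apply Cg].
          apply (ex_derive_continuous (fun y : R => - y)). auto_derive. exact I.
        - intros y. generalize (hg_between (- y)). lra.
        - intros t. destruct (phase_orbit_opp _ _ _ _ _ Hx t) as [D1 D2].
          split; [exact D1|]. now rewrite <- Ropp_plus_distr. }
      split; apply unbounded_on_opp; apply H. }
  split; [|exact Hunb]. split.
  - intros (x & Hx & Px).
    apply NNPP; intros Hmu. apply (proj1 (Hunb Hmu x Hx)).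
    destruct (periodic_continuous_bounded p x hp Px) as [K HK].
    { intros t. apply (ex_derive_continuous x), Hx. }
    exists K. auto.
  - intros Hmu.
    apply is_lim_spec in hg_pinf. apply is_lim_spec in hg_minf.
    destruct (hg_pinf (mkposreal (gpinf - mu) ltac:(lra))) as [Rp HRp].
    destruct (hg_minf (mkposreal (mu - gminf) ltac:(lra))) as [Rm HRm].
    simpl in HRp, HRm.
    assert (Hbig := conj (Rle_abs Rp) (Rle_abs (- Rm))). rewrite Rabs_Ropp in Hbig.
    assert (Hpos := conj (Rabs_pos Rp) (Rabs_pos Rm)).
    apply (periodic_solution_exists lam mu p M (lam ^ 2 / 4 + omega ^ 2)
             (Rabs Rp + Rabs Rm + 1)); auto.
    + generalize (hg_deriv 0) (Rabs_pos (Derive g 0)). lra.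
    + intros x y. apply (bounded_variation g (Derive g)). intros t _. split.
      * apply Derive_correct, hg_C1.
      * apply Rlt_le, hg_deriv.
    + lra.
    + intros y Hy. generalize (Rabs_def2 _ _ (HRp y ltac:(lra))). lra.
    + intros y Hy. generalize (Rabs_def2 _ _ (HRm y ltac:(lra))). lra.
Qed.
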